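(* Let $\ell\ge 2$ and $m\ge 1$ be integers. For integers $s,r\geq 2$, with $F=\left\lfloor \frac{\sqrt{1+8(r-1)(s-1)}-1}{2}\right\rfloor+r+s$, \begin{align*} \log_\ell F\leq\operatorname{PR}_{\mathcal{Q}(\ell)}^2(\vee_r,\wedge_s)\leq\left\lceil\log_{(\ell+1)/2}(r+s-1)\right\rceil \quad\text{and}\quad F^{1/m}\leq \operatorname{PR}_{\mathcal{H}(m)}^2(\vee_r,\wedge_s)\leq \left\lceil 2(r+s-1)^{1/m}\right\rceil-1. \end{align*}
   Context: $[\ell]^m$ denotes the grid poset of $m$-tuples with entries in $\{1,\dots,\ell\}$, ordered coordinatewise. $\mathcal{Q}(\ell)=\{Q_n(\ell):n\ge1\}$ with $Q_n(\ell)=[\ell]^n$, and $\mathcal{H}(m)=\{H_n(m):n\ge1\}$ with $H_n(m)=[n]^m$. The $r$-cup $\vee_r$ is the 2-uniform pograph on $\{x,y_1,\dots,y_r\}$ with $x\le y_i$ and edges $xy_i$; the $s$-cap $\wedge_s$ is the pograph on $\{y,x_1,\dots,x_s\}$ with $x_i\le y$ and edges $x_iy$. Given a coloring of the comparable pairs of a poset $Q$, a copy of $H$ in color $i$ is an injection $f:V(H)\to Q$ with $f(x)\le f(y)$ whenever $x\le y$ such that every edge of $H$ is mapped to a pair of color $i$. For a family $\mathcal{P}=\{P_n\}$, $\operatorname{PR}_{\mathcal{P}}^2(G_1,G_2)$ is the least $N$ such that every 2-coloring of the comparable pairs of $P_N$ contains a copy of $G_1$ in color 1 or of $G_2$ in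 color 2. *)

(* Defs.v *)
From HB Require Import structures.
From mathcomp Require Import all_boot all_order all_algebra.
From mathcomp Require Import reals exp.

Set Implicit Arguments.
Unset Strict Implicit.
Unset Printing Implicit Defensive.

Import Order.TTheory.

Local Open Scope order_scope.

(* A 2-uniform pograph: a finite poset with a graph on comparable pairs.  An
   edge is recorded once, from its lower to its upper endpoint. *)
Record pograph (d : Order.disp_t) := Pograph {
  vertex : finPOrderType d;
  edge : rel vertex;
  edge_lt : forall x y, edge x y -> x < y
}.

Fact pograph_display : Order.disp_t.
Proof. exact: Order.Disp tt tt. Qed.

(* [None] is the bottom x, and [Some i] is y_{i+1}. *)
Definition cup_vertex (r : nat) : Type := option 'I_r.
HB.instance Definition _ r := Finite.copy (cup_vertex r) (option 'I_r).

Definition cup_le r : rel (cup_vertex r) := fun a b => (a == None) || (a == b).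

Fact cup_le_refl r : reflexive (@cup_le r).
Proof. by move=> a; rewrite /cup_le eqxx orbT. Qed.

Fact cup_le_anti r : antisymmetric (@cup_le r).
Proof. by move=> [i|] [j|] //= /andP[/eqP]. Qed.

Fact cup_le_trans r : transitive (@cup_le r).
Proof. by move=> b a c /orP[/eqP->|/eqP->]. Qed.

HB.instance Definition _ r :=
  Order.Le_isPOrder.Build pograph_display (cup_vertex r)
    (@cup_le_refl r) (@cup_le_anti r) (@cup_le_trans r).

Definition cup_edge r : rel (cup_vertex r) :=
  fun a b => (a == None) && (b != None).

Fact cup_edge_lt r (a b : cup_vertex r) : cup_edge a b -> a < b.
Proof. by rewrite lt_neqAle; case: a; case: b. Qed.

Definition cup (r : nat) : pograph pograph_display :=
  Pograph (@cup_edge_lt r).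

(* [None] is the top y, and [Some i] is x_{i+1}. *)
Definition cap_vertex (s : nat) : Type := option 'I_s.
HB.instance Definition _ s := Finite.copy (cap_vertex s) (option 'I_s).

Definition cap_le s : rel (cap_vertex s) := fun a b => (b == None) || (a == b).

Fact cap_le_refl s : reflexive (@cap_le s).
Proof. by move=> a; rewrite /cap_le eqxx orbT. Qed.

Fact cap_le_anti s : antisymmetric (@cap_le s).
Proof. by move=> [i|] [j|] //= /andP[/eqP]. Qed.

Fact cap_le_trans s : transitive (@cap_le s).
Proof. by move=> b a c + /orP[/eqP->|/eqP<-//]. Qed.

HB.instance Definition _ s :=
  Order.Le_isPOrder.Build pograph_display (cap_vertex s)
    (@cap_le_refl s) (@cap_le_anti s) (@cap_le_trans s).

Definition cap_edge s : rel (cap_vertex s) :=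
  fun a b => (b == None) && (a != None).

Fact cap_edge_lt s (a b : cap_vertex s) : cap_edge a b -> a < b.
Proof. by rewrite lt_neqAle; case: a; case: b. Qed.

Definition cap (s : nat) : pograph pograph_display :=
  Pograph (@cap_edge_lt s).

(* A 2-coloring of the comparable pairs of Q is a function c : Q -> Q -> 'I_2;
   the color of a pair x < y is c x y, and all other values of c are ignored
   (a copy maps an edge x < y to a pair f x < f y).  Color 1 is
   [ord0] and color 2 is [ord_max]. *)
Definition has_copy d d' (H : pograph d) (Q : finPOrderType d')
    (c : Q -> Q -> 'I_2) (i : 'I_2) : Prop :=
  exists f : vertex H -> Q,
    [/\ injective f,
        {homo f : x y / x <= y}
      & forall x y : vertex H, edge x y -> c (f x) (f y) = i].

Definition ramsey_arrows d d1 d2 (Q : finPOrderType d)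
    (G1 : pograph d1) (G2 : pograph d2) : Prop :=
  forall c : Q -> Q -> 'I_2,
    has_copy G1 c ord0 \/ has_copy G2 c ord_max.

(* N = PR^2_P(G1, G2) for the family P = {P_n : n >= 1}. *)
Definition is_poset_ramsey d d1 d2 (P : nat -> finPOrderType d)
    (G1 : pograph d1) (G2 : pograph d2) (N : nat) : Prop :=
  [/\ (1 <= N)%N,
      ramsey_arrows (P N) G1 G2
    & forall n : nat, (1 <= n)%N -> ramsey_arrows (P n) G1 G2 -> (N <= n)%N].

(* [l]^m with entries in {0, ..., l-1}; [tupleprod] carries the coordinatewise
   order. *)
Definition grid (l m : nat) : finPOrderType _ := m.-tupleprod 'I_l.

Definition Qfam (l n : nat) := grid l n.
Definition Hfam (m n : nat) := grid n m.

Local Open Scope ring_scope.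

Definition logb (R : realType) (b x : R) : R := ln x / ln b.

Definition cupcap_bound (R : realType) (r s : nat) : int :=
  Num.floor ((Num.sqrt (1 + 8 * (r%:R - 1) * (s%:R - 1) : R) - 1) / 2)
  + r%:Z + s%:Z.

(* Main.v *)
(* Put a = r - 1 and b = s - 1.  A coloring avoids both the cup and the cap iff
   every point has at most a color-1 pairs going up and at most b color-2 pairs
   going down.

   Upper bounds: such a coloring charges every pair x < y to one of its ends,
   so there are at most a + b pairs per point, and strictly fewer on average
   because the top point of the grid has nothing above it.  The grid [l]^m has
   (l(l+1)/2)^m pairs x <= y.

   Lower bounds: pulling back along a linear extension, it suffices to color a
   chain of a + b + k + 1 points, where k(k+1) <= 2ab.  Cut it into consecutive
   blocks B, M, T of sizes b, k + 1, a.  Pairs inside B get color 2, pairs inside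
   T get color 1, and pairs inside M get color 1 iff they are at distance at most
   a.  The quotas left over then prescribe how many color-2 pairs join each point
   of M to T, and how many color-1 pairs join each point of M and T to B; spreading
   both evenly respects the quotas in T and in B, because their total number is
   k(k+1)/2 <= ab. *)

Require Import Defs.
From HB Require Import structures.
From mathcomp Require Import all_boot all_order all_algebra.
From mathcomp Require Import boolp reals exp.
From mathcomp Require Import zify lra.

Set Implicit Arguments.
Unset Strict Implicit.
Unset Printing Implicit Defensive.

Import Order.TTheory.

(** * Cups and caps as degree conditions *)

(** Distinct [y_i] are incomparable in the cup, so a copy asks only that their images be distinct
    and joined to the image of the bottom in color [i]; any [r] such points, listed by [enum_val],
    will do. Containing a cup thus becomes a degree condition. *)
Lemma has_copy_cup d (Q : finPOrderType d) (c : Q -> Q -> 'I_2) (i : 'I_2) r :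
  has_copy (cup r) c i <->
  exists x, r <= #|[set y | (x < y)%O && (c x y == i)]|.
Proof.
split=> [[f [f_inj f_homo f_edge]]|[x]].
  exists (f None).
  rewrite -[X in X <= _](card_ord r).
  have f'_inj : injective (fun j : 'I_r => f (Some j : cup_vertex r)).
    by move=> j j' /f_inj[].
  rewrite -cardsT -(card_imset _ f'_inj) subset_leq_card //.
  apply/subsetP => _ /imsetP[j _ ->]; rewrite inE f_edge // eqxx andbT.
  rewrite lt_neqAle f_homo // andbT; apply/negP => /eqP/f_inj //.
set S := [set y | _] => le_rS.
pose g (j : 'I_r) := enum_val (widen_ord le_rS j).
have g_S j : (x < g j)%O /\ c x (g j) = i.
  by have := enum_valP (widen_ord le_rS j); rewrite inE => /andP[? /eqP].
have g_inj : injective g.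
  by move=> j j' /enum_val_inj/(congr1 val)/= /val_inj.
exists (fun o : cup_vertex r => if o is Some j then g j else x); split.
- move=> [j|] [j'|] //=.
  + by move=> /g_inj->.
  + by move=> E; have [] := g_S j; rewrite E ltxx.
  + by move=> E; have [] := g_S j'; rewrite -E ltxx.
- move=> [j|] [j'|] //=; first by move=> /eqP[->].
  by move=> _; apply/ltW; have [] := g_S j'.
- by move=> [j|] [j'|] //= _; have [] := g_S j'.
Qed.

Lemma has_copy_cap d (Q : finPOrderType d) (c : Q -> Q -> 'I_2) (i : 'I_2) s :
  has_copy (cap s) c i <->
  exists y, s <= #|[set x | (x < y)%O && (c x y == i)]|.
Proof.
split=> [[f [f_inj f_homo f_edge]]|[x]].
  exists (f None).
  rewrite -[X in X <= _](card_ord s).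
  have f'_inj : injective (fun j : 'I_s => f (Some j : cap_vertex s)).
    by move=> j j' /f_inj[].
  rewrite -cardsT -(card_imset _ f'_inj) subset_leq_card //.
  apply/subsetP => _ /imsetP[j _ ->]; rewrite inE f_edge // eqxx andbT.
  rewrite lt_neqAle f_homo // andbT; apply/negP => /eqP/f_inj //.
set S := [set y | _] => le_sS.
pose g (j : 'I_s) := enum_val (widen_ord le_sS j).
have g_S j : (g j < x)%O /\ c (g j) x = i.
  by have := enum_valP (widen_ord le_sS j); rewrite inE => /andP[? /eqP].
have g_inj : injective g.
  by move=> j j' /enum_val_inj/(congr1 val)/= /val_inj.
exists (fun o : cap_vertex s => if o is Some j then g j else x); split.
- move=> [j|] [j'|] //=.
  + by move=> /g_inj->.
  + by move=> E; have [] := g_S j; rewrite E ltxx.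
  + by move=> E; have [] := g_S j'; rewrite -E ltxx.
- move=> [j|] [j'|] //=; first by move=> /eqP[->].
  by move=> _; apply/ltW; have [] := g_S j.
- by move=> [j|] [j'|] //= _; have [] := g_S j.
Qed.

(** * Lower bounds: balanced colorings of a chain and their pullbacks *)

(** Points are sorted by the size of their strict down-set, with ties broken by [enum_rank]. The
    number of points with a smaller key then brings the values below [#|Q|]. *)
Lemma linear_extension d (Q : finPOrderType d) :
  exists g : Q -> nat,
    [/\ injective g, {homo g : x y / (x < y)%O >-> x < y}
      & forall x, g x < #|Q|].
Proof.
pose key (x : Q) := #|[set y | (y < x)%O]| * #|Q| + enum_rank x.
have key_inj : injective key.
  move=> x y; rewrite /key => E; apply: enum_rank_inj; apply: val_inj => /=.
  have := congr1 (modn^~ #|Q|) E; rewrite /= !modnMDl.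
  by rewrite !modn_small // ltn_ord.
have key_homo x y : (x < y)%O -> key x < key y.
  move=> lt_xy; have : #|[set z | (z < x)%O]| < #|[set z | (z < y)%O]|.
    apply/proper_card/properP; split.
      by apply/subsetP => z; rewrite !inE => /lt_trans; apply.
    by exists x; rewrite !inE // ltxx.
  move=> lt_down; apply: (@leq_trans (#|[set z | (z < x)%O]|.+1 * #|Q|)).
    by rewrite /key mulSn [ltnRHS]addnC ltn_add2l ltn_ord.
  by rewrite (leq_trans _ (leq_addr _ _)) // leq_mul2r lt_down orbT.
pose below (x : Q) := [set y | key y < key x].
have g_key x y : key x < key y -> #|below x| < #|below y|.
  move=> lt_xy; apply/proper_card/properP; split.
    by apply/subsetP => z; rewrite !inE => /ltn_trans; apply.
  by exists x; rewrite !inE // ltnn.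
exists (fun x => #|below x|); split => [x y E|x y /key_homo /g_key //|x].
  by case: (ltngtP (key x) (key y)) => [/g_key|/g_key|/key_inj //];
    rewrite E ltnn.
rewrite -cardsT; apply/proper_card/properP; split; first exact: subsetT.
by exists x; rewrite !inE // ltnn.
Qed.

(* The incidences are numbered consecutively, row after row, and the v-th one
   is put in column v mod b. *)
Lemma round_robin n a b (e : nat -> nat) :
    0 < b -> (forall j, j < n -> e j <= b) -> \sum_(j < n) e j <= a * b ->
  exists R : nat -> nat -> bool,
    (forall j, j < n -> \sum_(u < b) R j u = e j) /\
    (forall u, u < b -> \sum_(j < n) R j u <= a).
Proof.
move=> b_gt0 e_le sum_e.
pose c t u := \sum_(v < t) (v %% b == u).
pose S j := \sum_(i < j) e i.
have cS t u : c t.+1 u = c t u + (t %% b == u) by rewrite /c big_ord_recr.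
have sum_pick v : v < b -> \sum_(u < b) (v == u) = 1.
  move=> v_lt; rewrite (bigD1 (Ordinal v_lt)) //= eqxx big1 // => u.
  by rewrite eq_sym -val_eqE /= => /negbTE->.
have sum_c t : \sum_(u < b) c t u = t.
  rewrite exchange_big /= -[RHS]card_ord -sum1_card; apply: eq_bigr => v _.
  by rewrite sum_pick // ltn_mod.
have c_mono u t t' : t <= t' -> c t u <= c t' u.
  move=> /subnKC<-; elim: (t' - t) => [|p IH]; first by rewrite addn0.
  by rewrite addnS cS (leq_trans IH) // leq_addr.
have c_period u t : u < b -> c (t + b) u = (c t u).+1.
  move=> u_lt; elim: t => [|t IH].
    rewrite /c big_ord0 -(sum_pick u u_lt).
    by apply: eq_bigr => v _; rewrite modn_small // eq_sym.
  by rewrite addSn !cS IH modnDr.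
(* Since at most [a * b] incidences are dealt out, this bounds every column by [a]. *)
have c_mul u : u < b -> c (a * b) u = a.
  move=> u_lt; elim: (a) => [|p IH]; first by rewrite /c big_ord0.
  by rewrite mulSn addnC c_period // IH.
have SS j : S j.+1 = S j + e j by rewrite /S big_ord_recr.
(* Row [j] owns the numbers from [S j] up to, but excluding, [S j.+1]. As [e j <= b], these hit no
   column twice, so a boolean entry loses nothing. *)
pose R j u := c (S j) u < c (S j.+1) u.
have RE j u : j < n -> u < b -> c (S j.+1) u = c (S j) u + R j u.
  move=> j_lt u_lt; rewrite /R.
  have le1 : c (S j) u <= c (S j.+1) u by rewrite c_mono // SS leq_addr.
  have le2 : c (S j.+1) u <= (c (S j) u).+1.
    by rewrite -c_period // c_mono // SS leq_add2l e_le.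
  by case: ltnP => /=; lia.
exists R; split=> [j j_lt|u u_lt].
  apply/eqP; rewrite -(eqn_add2l (S j)) -SS -{1}(sum_c (S j)) -big_split /=.
  rewrite -[X in _ == X]sum_c; apply/eqP/eq_bigr => u _.
  by rewrite RE.
have -> : \sum_(j < n) R j u = c (S n) u.
  elim: n {sum_e e_le} RE => [|p IH] RE.
    by rewrite /S /c !big_ord0.
  rewrite big_ord_recr /= IH ?RE //.
  by move=> j v j_lt; apply: RE; rewrite ltnW.
by rewrite -[X in _ <= X](c_mul u) // c_mono.
Qed.
Lemma sum_interval n lo hi :
  \sum_(q < n) ((lo <= q) && (q < hi)) = minn hi n - lo.
Proof.
elim: n => [|n IH]; first by rewrite big_ord0; lia.
by rewrite big_ord_recr /= IH; lia.
Qed.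

Lemma chain_coloring a b k :
    0 < a -> 0 < b -> k * k.+1 <= 2 * (a * b) ->
  exists red : nat -> nat -> bool, let N := b + (k.+1 + a) in
    (forall i, i < N -> \sum_(j < N) ((i < j) && red i j) <= a) /\
    (forall j, j < N -> \sum_(i < N) ((i < j) && ~~ red i j) <= b).
Proof.
move=> a_gt0 b_gt0 k_bound.
have k_le : k <= a + b by nia.
(* Reversing the second sum pairs [p - a] with [minn a p]. With truncated subtraction they add up to
   [p], so the total is k(k+1)/2. *)
have sum_k : \sum_(p < k.+1) (p - a) + \sum_(p < k.+1) minn a (k - p) <= a * b.
  rewrite [X in _ + X](reindex_inj rev_ord_inj) /= -big_split /=.
  rewrite (eq_bigr (fun p : 'I_k.+1 => p : nat)); last first.
    by move=> p _; have := ltn_ord p; lia.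
  have -> : \sum_(p < k.+1) p = 'C(k.+1, 2).
    by rewrite -bin2_sum big_mkord.
  by rewrite bin2; move: k_bound => /=; move: (k * k.+1) (mulnC k k.+1); lia.
have sum_compl n (P : nat -> bool) :
    \sum_(u < n) ~~ P u + \sum_(u < n) P u = n.
  rewrite -big_split /= -[RHS]card_ord -sum1_card.
  by apply: eq_bigr => u _; case: (P u).
(* Point [p] of M has [minn a (k - p)] color-1 pairs going up inside M, so that many of its [a]
   pairs to T must get color 2; [R1] marks these. *)
have [||R1 [R1row R1col]] := @round_robin k.+1 b a (fun p => minn a (k - p)) a_gt0.
- by move=> p _; rewrite geq_minl.
- by rewrite mulnC; apply: leq_trans sum_k; rewrite leq_addl.
(* The number of color-2 pairs going down from point [j] of M and T to points of M. As many of its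
   [b] pairs to B must get color 1; [R2] marks these. *)
pose e j := if j < k.+1 then j - a else \sum_(p < k.+1) R1 p (j - k.+1).
have eT t : e (k.+1 + t) = \sum_(p < k.+1) R1 p t.
  by rewrite /e ltnNge leq_addr /= addKn.
have eM p : p < k.+1 -> e p = p - a by rewrite /e => ->.
have [||R2 [R2row R2col]] := @round_robin (k.+1 + a) a b e b_gt0.
- move=> j j_lt; rewrite /e; case: ifP => j_k; first by lia.
  by apply: R1col; lia.
- rewrite big_split_ord /= [X in X + _](eq_bigr (fun p : 'I_k.+1 => p - a)); last first.
    by move=> p _; rewrite eM.
  rewrite [X in _ + X](eq_bigr (fun t : 'I_a => \sum_(p < k.+1) R1 p t)); last first.
    by move=> t _; rewrite eT.
  rewrite exchange_big /=; apply: leq_trans sum_k; rewrite leq_add2l.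
  by apply: leq_sum => p _; rewrite R1row.
(* For [i < j], [red] means color 1. The tests treat in turn the pairs inside B, from B to the rest,
   inside M, from M to T, and inside T. *)
pose red i j := if j < b then false else if i < b then R2 (j - b) i
  else if j < b + k.+1 then j - i <= a
  else if i < b + k.+1 then ~~ R1 (i - b) (j - b - k.+1) else true.
have redB i q : i < b -> red i (b + q) = R2 q i.
  by move=> i_b; rewrite /red i_b ltnNge leq_addr addKn.
have redMM p q : q < k.+1 -> red (b + p) (b + q) = (q - p <= a).
  by move=> q_k; rewrite /red !ltnNge !leq_addr -ltnNge ltn_add2l q_k subnDl.
have redMT p t : p < k.+1 -> red (b + p) (b + (k.+1 + t)) = ~~ R1 p t.
  move=> p_k; rewrite /red addnA.
  by rewrite ltnNge -addnA leq_addr /= ltnNge leq_addr /= addnA ltnNge leq_addr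
    /= ltn_add2l p_k !addKn -addnA addKn addKn.
have redTT t t' : red (b + (k.+1 + t)) (b + (k.+1 + t')) = true.
  by rewrite /red !ltnNge !leq_addr !addnA !leq_addr.
exists red; split=> [i i_lt|j j_lt].
- rewrite big_split_ord /=.
  rewrite [X in X + _]big1 ?add0n; last first.
    by move=> j _; rewrite /red ltn_ord andbF.
  have [i_b|b_i] := ltnP i b.
    apply: leq_trans (R2col i i_b); apply: leq_sum => q _.
    by rewrite redB //; case: (R2 q i); rewrite ?andbF ?leq_b1.
  rewrite -(subnKC b_i) in i_lt *; move: (i - b) i_lt => {i b_i} p p_lt.
  rewrite big_split_ord /=.
  have [p_k|k_p] := ltnP p k.+1.
    (* The color-1 partners above [p] in M form an interval of [minn a (k - p)] points, exactly what
       row [p] of [R1] takes away from T. *)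
    rewrite [X in X + _](eq_bigr (fun q : 'I_k.+1 => (p.+1 <= q) && (q < p + a.+1) : nat)); last first.
      by move=> q _; rewrite redMM // ltn_add2l; lia.
    rewrite sum_interval.
    rewrite [X in _ + X](eq_bigr (fun t : 'I_a => ~~ R1 p t : nat)); last first.
      by move=> t _; rewrite redMT // ltn_add2l (leq_trans p_k) ?leq_addr.
    by have := sum_compl a (R1 p); rewrite R1row //; move: (\sum_(u < a) _) => x; lia.
  rewrite -(subnKC k_p); move: (p - k.+1) => t.
  rewrite big1 ?add0n; last by move=> q _; rewrite ltn_add2l; have := ltn_ord q; lia.
  rewrite -[X in _ <= X]card_ord -sum1_card; apply: leq_sum => q _; exact: leq_b1.
- have [j_b|b_j] := ltnP j b.
    apply: (@leq_trans (\sum_(i < b + (k.+1 + a)) ((0 <= i) && (i < j)))).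
      by apply: leq_sum => i _; case: (i < j); rewrite //= leq_b1.
    by rewrite sum_interval; lia.
  rewrite -(subnKC b_j) in j_lt *; move: (j - b) j_lt => {j b_j} q q_lt.
  rewrite ltn_add2l in q_lt.
  rewrite big_split_ord /=.
  rewrite [X in X + _](eq_bigr (fun i : 'I_b => ~~ R2 q i : nat)); last first.
    by move=> i _; rewrite redB // (leq_trans (ltn_ord i)) ?leq_addr.
  have := sum_compl b (R2 q); rewrite R2row // => sum_b.
  rewrite big_split_ord /=.
  have [q_k|k_q] := ltnP q k.+1.
    rewrite eM // in sum_b.
    rewrite [X in _ + (_ + X)]big1 ?addn0; last first.
      by move=> t _; rewrite ltn_add2l ltnNge (leq_trans (ltnW q_k)) ?leq_addr.
    (* The color-2 partners below [q] in M are the [q - a] points at distance more than [a],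
       matching the row sum of [R2]. *)
    rewrite [X in _ + X](eq_bigr (fun p : 'I_k.+1 => (0 <= p) && (p < q - a) : nat)); last first.
      by move=> p _; rewrite redMM // ltn_add2l; lia.
    by rewrite sum_interval; move: sum_b; move: (\sum_(u < b) _) => x; lia.
  rewrite -(subnKC k_q) in sum_b *; move: (q - k.+1) sum_b => t; rewrite eT.
  rewrite [X in _ + (_ + X)]big1 ?addn0; last by move=> t' _; rewrite redTT andbF.
  move=> sum_b; rewrite -[X in _ <= X]sum_b leq_add2l; apply: leq_sum => p _.
  by rewrite redMT // negbK; case: (R1 p t); rewrite ?andbF ?leq_b1.
Qed.

Lemma card_le_sum_inj (T : finType) (S : {set T}) (g : T -> nat) N
    (P : pred nat) :
    injective g -> (forall x, g x < N) -> {in S, forall x, P (g x)} ->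
  #|S| <= \sum_(j < N) P j.
Proof.
move=> g_inj g_lt S_P.
pose h x : 'I_N := Ordinal (g_lt x).
have h_inj : injective h by move=> x y /(congr1 val) /g_inj.
rewrite -(card_imset _ h_inj) (eq_bigr (fun j : 'I_N => if P j then 1 else 0)).
  rewrite -big_mkcond sum1_card; apply/subset_leq_card/subsetP.
  by move=> _ /imsetP[x /S_P Px ->].
by move=> j _; case: (P j).
Qed.

(** With a = r - 1 and b = s - 1 the colored chain has k + r + s - 1 points, so a smaller [Q] embeds
    in it by a linear extension and inherits the degree bounds. *)
Lemma ramsey_lower_bound d (Q : finPOrderType d) r s k :
    1 < r -> 1 < s -> k * k.+1 <= 2 * (r.-1 * s.-1) ->
  ramsey_arrows Q (cup r) (cap s) -> k + r + s <= #|Q|.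
Proof.
move=> r_gt1 s_gt1 k_bound arrow; rewrite leqNgt; apply/negP => Q_small.
have [||red [red_up red_down]] := chain_coloring _ _ k_bound; try lia.
set N := s.-1 + _ in red_up red_down.
have [g [g_inj g_homo g_lt]] := linear_extension Q.
have g_ltN x : g x < N by have := g_lt x; rewrite /N; lia.
have [/has_copy_cup[x]|/has_copy_cap[y]] :=
    arrow (fun x y => if red (g x) (g y) then ord0 else ord_max).
- move=> le_r; have := red_up _ (g_ltN x); rewrite leqNgt => /negP; apply.
  rewrite prednK ?(ltnW r_gt1) //; apply: leq_trans le_r _.
  apply: (@card_le_sum_inj _ _ g N (fun j => (g x < j) && red (g x) j)) => // y.
  by rewrite inE => /andP[/g_homo->]; case: (red _ _).
- move=> le_s; have := red_down _ (g_ltN y); rewrite leqNgt => /negP; apply.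
  rewrite prednK ?(ltnW s_gt1) //; apply: leq_trans le_s _.
  apply: (@card_le_sum_inj _ _ g N (fun i => (i < g y) && ~~ red i (g y))) => // x.
  by rewrite inE => /andP[/g_homo->]; case: (red _ _).
Qed.

(** * Upper bounds: counting comparable pairs *)

(** Writing n for [#|Q|], a coloring with neither copy leaves at most n + (n - 1)(r - 1) + n(s - 1)
    pairs x <= y, the first term being the reflexive ones. This is n(r + s - 1) - (r - 1), too few
    because r > 1. *)
Lemma ramsey_arrows_of_pairs d (Q : finPOrderType d) (top : Q) r s :
    (forall x, x <= top)%O -> 1 < r -> 0 < s ->
    #|Q| * (r + s).-1 <= \sum_(x : Q) \sum_(y : Q) (x <= y)%O ->
  ramsey_arrows Q (cup r) (cap s).
Proof.
move=> le_top r_gt1 s_gt0 pairs c; apply: contrapT => /not_orP[no_cup no_cap].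
pose up x := #|[set y | (x < y)%O && (c x y == ord0)]|.
pose down y := #|[set x | (x < y)%O && (c x y == ord_max)]|.
have up_lt x : up x < r.
  by rewrite ltnNge; apply/negP => le_r; apply/no_cup/has_copy_cup; exists x.
have down_lt y : down y < s.
  by rewrite ltnNge; apply/negP => le_s; apply/no_cap/has_copy_cap; exists y.
have up_top : up top = 0.
  apply/eqP; rewrite cards_eq0; apply/eqP/setP => y.
  by rewrite !inE lt_leAnge le_top andbF.
move: pairs.
(* A pair x <= y is an equality, or has color 1 and is charged to x, or has color 2 and is charged
   to y. *)
have -> : \sum_(x : Q) \sum_(y : Q) (x <= y)%O =
          #|Q| + (\sum_x up x + \sum_y down y).
  have -> : \sum_y down y =
      \sum_(x : Q) \sum_(y : Q) ((x < y)%O && (c x y == ord_max)).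
    rewrite exchange_big; apply: eq_bigr => y _.
    by rewrite /down -sum1dep_card big_mkcond; apply: eq_bigr => x _; case: ifP.
  rewrite -sum1_card -!big_split /=; apply: eq_bigr => x _.
  have one : \sum_(y : Q) (x == y) = 1.
    rewrite (bigD1 x) //= eqxx big1 // => y.
    by rewrite eq_sym => /negbTE->.
  rewrite -[X in X + _]one.
  have -> : up x = \sum_(y : Q) ((x < y)%O && (c x y == ord0)).
    by rewrite /up -sum1dep_card big_mkcond; apply: eq_bigr => y _; case: ifP.
  rewrite -!big_split /=; apply: eq_bigr => y _.
  rewrite le_eqVlt; case: eqVneq => [->|_]; first by rewrite ltxx.
  case: (x < y)%O => //=.
  by case: (c x y) => [[|[|//]] ?].
have sum_up : \sum_x up x <= #|Q|.-1 * r.-1.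
  rewrite (bigD1 top) //= up_top add0n.
  rewrite -(cardC1 top) -sum_nat_const; apply: leq_sum => x _.
  by have := up_lt x; lia.
have sum_down : \sum_x down x <= #|Q| * s.-1.
  by rewrite -sum_nat_const; apply: leq_sum => x _; have := down_lt x; lia.
have Q_gt0 : 0 < #|Q| by apply/card_gt0P; exists top.
move: sum_up sum_down Q_gt0; move: #|Q| (\sum_x up x) (\sum_x down x); nia.
Qed.

(** The order is coordinatewise, so the count is the m-th power of the count l(l+1)/2 for one
    coordinate; the factor [2 ^ m] avoids division. *)
Lemma grid_le_pairs l m :
  2 ^ m * (\sum_(x : grid l m) \sum_(y : grid l m) (x <= y)%O) = (l * l.+1) ^ m.
Proof.
have reindex_grid (G : grid l m -> nat) :
    \sum_(x : grid l m) G x = \sum_(f : {ffun 'I_m -> 'I_l}) G [tuple f i | i < m].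
  rewrite (reindex (fun f : {ffun 'I_m -> 'I_l} => [tuple f i | i < m])) //=.
  exists (fun t : grid l m => [ffun i => tnth t i]) => [f _|t _].
    by apply/ffunP => i; rewrite ffunE tnth_mktuple.
  by apply: eq_from_tnth => i; rewrite tnth_mktuple ffunE.
have le_prod (f g : {ffun 'I_m -> 'I_l}) :
    ([tuple f i | i < m] <= [tuple g i | i < m] :> grid l m)%O =
      \prod_(i < m) (f i <= g i)%O :> nat.
  rewrite leEtprod; case: (boolP [forall i, _]) => [/forallP all_le|].
    by rewrite big1 // => i _; have := all_le i; rewrite !tnth_mktuple => ->.
  rewrite negb_forall => /existsP[i]; rewrite !tnth_mktuple => /negbTE not_le.
  by rewrite (bigD1 i) //= not_le mul0n.
rewrite reindex_grid.
under eq_bigr => f _ do rewrite reindex_grid.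
under eq_bigr => f _ do under eq_bigr => g _ do rewrite le_prod.
(* Distributivity turns a sum over functions of products into a product of sums, first over [g],
   then over [f]. *)
under eq_bigr => f _ do rewrite -(bigA_distr_bigA (fun i v => (f i <= v)%O : nat)).
rewrite -(bigA_distr_bigA (fun i u => \sum_(v < l) (u <= v)%O)) /=.
rewrite big_const_ord iter_muln_1 -expnMn; congr (_ ^ _).
under eq_bigr => u _.
  under eq_bigr => v _ do rewrite leEord -[u <= v]andbT -(ltn_ord v).
  rewrite sum_interval minnn.
  over.
elim: l {reindex_grid le_prod} => [|l IH]; first by rewrite big_ord0.
rewrite big_ord_recl /= subn0.
under eq_bigr => u _ do rewrite /bump /= add1n subSS.
by rewrite mulnDr IH; lia.
Qed.

Lemma card_grid l m : #|grid l m| = l ^ m.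
Proof. by rewrite card_tuple card_ord. Qed.

(** This is the pair-counting criterion for the grid after cancelling the number [l ^ m] of
    points. *)
Lemma grid_ramsey_arrows l m r s :
    0 < l -> 1 < r -> 0 < s -> 2 ^ m * (r + s).-1 <= l.+1 ^ m ->
  ramsey_arrows (grid l m) (cup r) (cap s).
Proof.
case: l => // l _ r_gt1 s_gt0 grid_large.
apply: (@ramsey_arrows_of_pairs _ _ ([tuple ord_max | i < m] : grid l.+1 m)) => //.
  move=> x; rewrite leEtprod; apply/forallP => i.
  by rewrite tnth_mktuple leEord leq_ord.
rewrite card_grid -(@leq_pmul2l (2 ^ m)) ?expn_gt0 // grid_le_pairs.
by rewrite mulnCA expnMn leq_mul2l grid_large orbT.
Qed.

(** * From counting inequalities to the real bounds *)

(** Classical logic makes the arrow relation boolean, so that [ex_minn] can pick the least index. *)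
Lemma least_ramsey_arrows d d1 d2 (P : nat -> finPOrderType d)
    (G1 : pograph d1) (G2 : pograph d2) n :
    1 <= n -> ramsey_arrows (P n) G1 G2 ->
  exists2 N, is_poset_ramsey P G1 G2 N & N <= n.
Proof.
move=> n_gt0 arrow.
pose p k := (1 <= k) && `[< ramsey_arrows (P k) G1 G2 >].
have p_n : exists k, p k by exists n; rewrite /p n_gt0; apply/asboolP.
exists (ex_minn p_n); case: ex_minnP => N /andP[N_gt0 /asboolP arrN] min_N.
  by split=> // k k_gt0 arrk; apply: min_N; rewrite /p k_gt0; apply/asboolP.
by apply: min_N; rewrite /p n_gt0; apply/asboolP.
Qed.

Import GRing.Theory Num.Theory.
Local Open Scope ring_scope.

Lemma cupcap_bound_ge (R : realType) (r s : nat) :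
    (1 < r)%N -> (1 < s)%N -> r%:Z + s%:Z <= cupcap_bound R r s.
Proof.
move=> r_gt1 s_gt1; rewrite /cupcap_bound -addrA lerDr floor_ge0.
have r1 : (1 : R) <= r%:R by rewrite ler1n ltnW.
have s1 : (1 : R) <= s%:R by rewrite ler1n ltnW.
rewrite divr_ge0 // subr_ge0 -[leLHS]sqrtr1 ler_wsqrtr // lerDl.
by rewrite !mulr_ge0 // subr_ge0.
Qed.

(** The floor is the largest k with (2k + 1)^2 <= 1 + 8(r - 1)(s - 1), that is, k(k + 1) <= 2(r -
    1)(s - 1), which is the condition under which the chain can be colored. *)
Lemma cupcap_bound_le_card (R : realType) d (Q : finPOrderType d) (r s : nat) :
    (1 < r)%N -> (1 < s)%N -> ramsey_arrows Q (cup r) (cap s) ->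
  cupcap_bound R r s <= #|Q|%:Z.
Proof.
move=> r_gt1 s_gt1 arrow.
have := cupcap_bound_ge R r_gt1 s_gt1; rewrite /cupcap_bound.
set z := Num.floor _ => z_ge.
have [k zk] : exists k : nat, z = k%:Z by exists `|z|%N; lia.
have : k%:Z <= z by rewrite zk.
rewrite {1}/z floor_ge_int ler_pdivlMr // lerBrDr => le_sqrt.
suff : (k + r + s <= #|Q|)%N by rewrite zk -!PoszD lez_nat.
apply: ramsey_lower_bound => //.
have r1 : (1 : R) <= r%:R by rewrite ler1n ltnW.
have s1 : (1 : R) <= s%:R by rewrite ler1n ltnW.
have arg_ge0 : 0 <= 1 + 8 * (r%:R - 1) * (s%:R - 1) :> R.
  by rewrite addr_ge0 // !mulr_ge0 // subr_ge0.
have k_ge0 : 0 <= k%:R :> R by [].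
have : (k%:R * 2 + 1) ^+ 2 <= 1 + 8 * (r%:R - 1) * (s%:R - 1) :> R.
  rewrite -[leRHS]sqr_sqrtr // lerXn2r // nnegrE ?sqrtr_ge0 //.
  by rewrite addr_ge0 // mulr_ge0.
rewrite -(@ler_nat R) !natrM -(natr1 k) -!subn1 !natrB ?(ltnW r_gt1) ?(ltnW s_gt1) //.
clear; rewrite expr2; lra.
Qed.

Lemma grid_ramsey_arrows_real (R : realType) l m r s :
    (0 < l)%N -> (1 < r)%N -> (1 < s)%N ->
    r%:R + s%:R - 1 <= ((l%:R + 1) / 2) ^+ m :> R ->
  ramsey_arrows (grid l m) (cup r) (cap s).
Proof.
move=> l_gt0 r_gt1 s_gt1 le_pow; apply: grid_ramsey_arrows => //; first exact: ltnW.
rewrite -(@ler_nat R) natrM !natrX -subn1 natrB ?natrD; last by lia.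
by rewrite -(natr1 l) mulrC -ler_pdivlMr ?exprn_gt0 // -expr_div_n.
Qed.

Theorem theorem5p2 (R : realType) (l m r s : nat)
    (hl : (2 <= l)%N) (hm : (1 <= m)%N) (hs : (2 <= s)%N) (hr : (2 <= r)%N) :
  let F : R := (cupcap_bound R r s)%:~R in
  (exists N : nat,
     [/\ is_poset_ramsey (Qfam l) (cup r) (cap s) N,
         logb l%:R F <= N%:R
       & N%:Z <= Num.ceil (logb ((l%:R + 1) / 2) (r%:R + s%:R - 1 : R))]) /\
  (exists M : nat,
     [/\ is_poset_ramsey (Hfam m) (cup r) (cap s) M,
         F `^ (m%:R)^-1 <= M%:R
       & M%:Z <= Num.ceil (2 * (r%:R + s%:R - 1 : R) `^ (m%:R)^-1) - 1]).
Proof.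
move=> F.
have F_gt0 : 0 < F.
  by rewrite ltr0z; apply: lt_le_trans (cupcap_bound_ge R hr hs); lia.
have F_le d (Q : finPOrderType d) :
    ramsey_arrows Q (cup r) (cap s) -> F <= #|Q|%:R.
  by move=> /(cupcap_bound_le_card R hr hs); rewrite -(ler_int R).
have r2 : (2 : R) <= r%:R by rewrite ler_nat.
have s2 : (2 : R) <= s%:R by rewrite ler_nat.
have l2 : (2 : R) <= l%:R by rewrite ler_nat.
have m0 : (0 : R) < m%:R by rewrite ltr0n.
set q : R := r%:R + s%:R - 1.
have q_gt1 : 1 < q by rewrite /q; lra.
have q_gt0 : 0 < q by apply: lt_trans q_gt1.
split.
- set b : R := (l%:R + 1) / 2.
  have b_gt1 : 1 < b by rewrite /b; lra.
  have b_gt0 : 0 < b by apply: lt_trans b_gt1.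
  have log_gt0 : 0 < logb b q by rewrite divr_gt0 ?ln_gt0.
  (* The grid of dimension [n] arrows, since b^n >= q is the counting criterion. *)
  have [n nE] : exists n : nat, Num.ceil (logb b q) = n%:Z.
    exists `|Num.ceil (logb b q)|%N.
    by rewrite gez0_abs // ceil_ge0 (lt_trans _ log_gt0) // ltrN10.
  have log_le : logb b q <= n%:R by have := ceil_ge (logb b q); rewrite nE.
  have n_gt0 : (0 < n)%N by rewrite -(ltr0n R); apply: lt_le_trans log_le.
  have [|N N_ramsey N_le] := @least_ramsey_arrows _ _ _ (Qfam l) (cup r) (cap s) n n_gt0.
    apply: (@grid_ramsey_arrows_real R) => //; first exact: ltnW.
    by rewrite -ler_ln ?posrE ?exprn_gt0 // lnXn // -(mulr_natl (ln b)) -ler_pdivrMr ?ln_gt0 //.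
  exists N; split=> //; last by rewrite nE.
  (* The arrowing grid has at least [F] points, so F <= l^N; taking logarithms gives the lower
     bound. *)
  have [_ /F_le + _] := N_ramsey; rewrite card_grid natrX => F_leN.
  rewrite /logb ler_pdivrMr ?ln_gt0 //; last by lra.
  rewrite mulr_natl -lnXn; last by lra.
  by rewrite ler_ln ?posrE // exprn_gt0 //; lra.
- set t := q `^ _.
  have t_gt1 : 1 < t.
    have <- : (1 : R) `^ (m%:R)^-1 = 1 by rewrite powR1.
    by apply: gt0_ltr_powR; rewrite ?invr_gt0 // nnegrE // ltW.
  have tX : t ^+ m = q by rewrite -powR_mulrn ?powR_ge0 // -powRrM mulVf ?powRr1 ?lt0r_neq0 // ltW.
  (* The side is [n.+1], one less than the ceiling: the criterion compares t with half of the side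
     plus one, that is, with (n + 2)/2. Since t > 1 the ceiling exceeds 2, so this side is
     positive. *)
  have [n nE] : exists n : nat, Num.ceil (2 * t) = n.+2%:Z.
    have : 2 < Num.ceil (2 * t) by rewrite ceil_gt_int; lra.
    by exists `|Num.ceil (2 * t) - 2|%N; lia.
  have t_le : 2 * t <= n.+2%:R by have := ceil_ge (2 * t); rewrite nE.
  have [|M M_ramsey M_le] :=
    @least_ramsey_arrows _ _ _ (Hfam m) (cup r) (cap s) n.+1 (ltn0Sn n).
    apply: (@grid_ramsey_arrows_real R) => //.
    rewrite natr1 -[leLHS]tX; apply: lerXn2r; rewrite ?nnegrE.
    - exact: powR_ge0.
    - by rewrite divr_ge0.
    - by rewrite ler_pdivlMr // mulrC.
  exists M; split=> //; last by rewrite nE; lia.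
  have [_ /F_le + _] := M_ramsey; rewrite card_grid natrX => F_leM.
  have -> : M%:R = (M%:R ^+ m) `^ (m%:R)^-1 :> R.
    by rewrite -powR_mulrn // -powRrM mulfV ?lt0r_neq0 // powRr1.
  by apply: ge0_ler_powR; rewrite ?nnegrE ?invr_ge0 // ?exprn_ge0 // ltW.
Qed.
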